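(* Let $\Phi:S\to S$ be an affine automorphism of the separable state space $S=S_{m,n}$. If $m\neq n$, there exist unique affine automorphisms $\psi_1:K_m\to K_m$ and $\psi_2:K_n\to K_n$ such that $\Phi=\psi_1\otimes\psi_2$, i.e. $\Phi(\omega\otimes\sigma)=\psi_1(\omega)\otimes\psi_2(\sigma)$ for all $\omega\in K_m,\sigma\in K_n$. If $m=n$, then either $\Phi=\psi_1\otimes\psi_2$ or $\Phi=\alpha_{m,m}\circ(\psi_1\otimes\psi_2)$, where $\psi_1,\psi_2$ are again unique affine automorphisms of $K_m$ and $K_n$ respectively.
   Context: $K_p$ is the state space of $\mathcal{B}(\mathbb{C}^p)$; $S_{m,n}$ is the convex set of separable states on $\mathcal{B}(\mathbb{C}^m\otimes\mathbb{C}^n)\cong\mathcal{B}(\mathbb{C}^m)\otimes\mathcal{B}(\mathbb{C}^n)$. For affine automorphisms $\psi_1$ of $K_m$ and $\psi_2$ of $K_n$, $\psi_1\otimes\psi_2$ denotes the tensor product of their unique linear extensions to the linear spans; it maps $S$ onto $S$. The swap automorphism $\alpha_{m,m}$ is the dual of the *-automorphism of $\mathcal{B}(\mathbb{C}^m)\otimes\mathcal{B}(\mathbb{C}^m)$ sending $A\otimes B\mapsto B\otimes A$; it satisfies $\alpha_{m,m}(\omega\otimes\sigma)=\sigma\otimes\omega$. *)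

(* Defs.v *)
(* Complex scalars: an arbitrary numClosedFieldType C. *)
From HB Require Import structures.
From mathcomp Require Import all_boot all_order all_algebra.
From mathcomp Require Import sesquilinear.
Set Implicit Arguments. Unset Strict Implicit. Unset Printing Implicit Defensive.
Import Order.TTheory GRing.Theory Num.Theory.
Local Open Scope ring_scope.
Local Open Scope sesquilinear_scope.

Section Defs.
Variable C : numClosedFieldType.

(* Positive semidefinite matrices: hermitian with v A v^* >= 0 for all v. *)
Definition psdmx (p : nat) (A : 'M[C]_p) : Prop :=
  A^t* = A /\ forall v : 'rV[C]_p, 0 <= (v *m A *m v^t*) 0 0.

(* K_p : the state space of B(C^p), identified with density matrices. *)
Definition state (p : nat) (A : 'M[C]_p) : Prop := psdmx A /\ \tr A = 1.

(* Kronecker (tensor) product of matrices, A (x) B acting on C^m (x) C^n,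
   with the basis of C^m (x) C^n indexed by mxvec_index. *)
Definition kronmx (m n : nat) (A : 'M[C]_m) (B : 'M[C]_n) : 'M[C]_(m * n) :=
  \sum_(i < m) \sum_(j < m) \sum_(k < n) \sum_(l < n)
     (A i j * B k l) *: delta_mx (mxvec_index i k) (mxvec_index j l).

(* S_{m,n} : separable states = convex hull of product states. *)
Definition separable (m n : nat) (X : 'M[C]_(m * n)) : Prop :=
  exists (N : nat) (lam : 'I_N -> C) (w : 'I_N -> 'M[C]_m) (s : 'I_N -> 'M[C]_n),
    (forall i, 0 <= lam i) /\ \sum_(i < N) lam i = 1 /\
    (forall i, state (w i)) /\ (forall i, state (s i)) /\
    X = \sum_(i < N) lam i *: kronmx (w i) (s i).

(* Affine automorphism of a convex set K (given as a predicate), represented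
   by a function on the ambient space; only its values on K matter. *)
Definition affine_aut (V : lmodType C) (K : V -> Prop) (f : V -> V) : Prop :=
  (forall x, K x -> K (f x)) /\
  (forall x y, K x -> K y -> f x = f y -> x = y) /\
  (forall y, K y -> exists2 x, K x & f x = y) /\
  (forall (t : C) x y, 0 <= t -> t <= 1 -> K x -> K y ->
     f (t *: x + (1 - t) *: y) = t *: f x + (1 - t) *: f y).

(* Phi = psi1 (x) psi2 on product states. *)
Definition is_tensor_of (m n : nat) (Phi : 'M[C]_(m * n) -> 'M[C]_(m * n))
  (psi1 : 'M[C]_m -> 'M[C]_m) (psi2 : 'M[C]_n -> 'M[C]_n) : Prop :=
  forall w s, state w -> state s -> Phi (kronmx w s) = kronmx (psi1 w) (psi2 s).

(* Phi = alpha_{m,m} o (psi1 (x) psi2) on product states. *)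
Definition is_swap_tensor_of (m : nat) (Phi : 'M[C]_(m * m) -> 'M[C]_(m * m))
  (psi1 psi2 : 'M[C]_m -> 'M[C]_m) : Prop :=
  forall w s, state w -> state s -> Phi (kronmx w s) = kronmx (psi2 s) (psi1 w).

(* Existence of affine automorphisms psi1, psi2 of K_m, K_n with P psi1 psi2,
   unique as maps on K_m and K_n. *)
Definition exists_unique_auts (m n : nat)
  (P : ('M[C]_m -> 'M[C]_m) -> ('M[C]_n -> 'M[C]_n) -> Prop) : Prop :=
  exists psi1 psi2,
    [/\ affine_aut (@state m) psi1, affine_aut (@state n) psi2, P psi1 psi2 &
        forall phi1 phi2, affine_aut (@state m) phi1 -> affine_aut (@state n) phi2 ->
          P phi1 phi2 ->
          (forall w, state w -> phi1 w = psi1 w) /\ (forall s, state s -> phi2 s = psi2 s)].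

End Defs.

(* Main.v *)
(* The extreme points of the separable states are the pure product states
   P (x) Q, so an affine automorphism Phi permutes them.  The midpoint of two
   distinct pure product states has a second decomposition into pure product
   states exactly when the two share a factor (otherwise the span of the two
   product vectors contains no third product vector), so Phi induces an
   automorphism of the rook graph on pairs (P, Q).  Such an automorphism either
   respects the two coordinates or exchanges them.  Partial traces then turn the
   two coordinate maps into affine isomorphisms of state spaces, and K_m and K_n
   are affinely isomorphic only if m = n, because the maximally mixed state of
   K_m is not a convex combination of fewer than m pure states. *)
Require Import Defs.
From HB Require Import structures.
From mathcomp Require Import all_boot all_order all_algebra.
From mathcomp Require Import sesquilinear spectral ring.
Import Order.TTheory GRing.Theory Num.Theory.
Local Open Scope ring_scope.
Local Open Scope sesquilinear_scope.
Set Implicit Arguments. Unset Strict Implicit. Unset Printing Implicit Defensive.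

(** * Affine maps and finite convex combinations *)

Section AffineMaps.
Variable C : numClosedFieldType.

Definition affine_on (V V' : lmodType C) (K : V -> Prop) (f : V -> V') : Prop :=
  forall (t : C) x y, 0 <= t -> t <= 1 -> K x -> K y ->
    f (t *: x + (1 - t) *: y) = t *: f x + (1 - t) *: f y.

(** Source and target may differ, because composing an automorphism of $S_{m,n}$ with the swap gives
    a map into $S_{n,m}$. *)
Definition affine_iso (V V' : lmodType C) (K : V -> Prop) (K' : V' -> Prop)
    (f : V -> V') : Prop :=
  [/\ forall x, K x -> K' (f x),
      forall x y, K x -> K y -> f x = f y -> x = y,
      forall y, K' y -> exists2 x, K x & f x = y
    & affine_on K f].

Lemma affine_iso_aut (V : lmodType C) (K : V -> Prop) (f : V -> V) :
  affine_iso K K f <-> affine_aut K f.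
Proof. by split=> [[]|[? [? []]]]. Qed.

Definition convexp (V : lmodType C) (K : V -> Prop) : Prop :=
  forall (t : C) x y, 0 <= t -> t <= 1 -> K x -> K y -> K (t *: x + (1 - t) *: y).

Definition weights (N : nat) (lam : 'I_N -> C) : Prop :=
  (forall i, 0 <= lam i) /\ \sum_i lam i = 1.

(** Induction on the number of terms: split off the first one and renormalise the others by their
    total weight [s]. Membership in [K] is carried along because affinity applies only to points of
    [K]. *)
Lemma affine_on_sum (V V' : lmodType C) (K : V -> Prop) (f : V -> V') :
    convexp K -> affine_on K f ->
  forall N (lam : 'I_N -> C) (x : 'I_N -> V),
    weights lam -> (forall i, K (x i)) ->
    K (\sum_i lam i *: x i) /\ f (\sum_i lam i *: x i) = \sum_i lam i *: f (x i).
Proof.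
move=> cK af; elim=> [|N IH] lam x [lam0 lam1] Kx.
  by move: lam1; rewrite big_ord0 => /eqP; rewrite eq_sym oner_eq0.
rewrite !big_ord_recl; move: lam1; rewrite big_ord_recl.
set s := \sum_i _ => lam1.
have s0 : 0 <= s by apply: sumr_ge0.
(* Renormalising divides by [s]; if [s = 0], the first term alone carries weight 1. *)
have [sE|sN0] := eqVneq s 0.
  have lamE i : lam (lift ord0 i) = 0.
    apply/eqP; move/eqP: sE; rewrite /s psumr_eq0// => /allP/(_ i).
    by rewrite mem_index_enum => /(_ isT).
  rewrite !big1; try by move=> i _; rewrite lamE scale0r.
  by move: lam1; rewrite sE !addr0 => ->; rewrite !scale1r; split.
have sE : s = 1 - lam ord0 by rewrite -lam1 addrC addKr.
have [||K1 f1] := IH (fun i => lam (lift ord0 i) / s) (fun i => x (lift ord0 i)).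
- split=> [i|]; first by rewrite divr_ge0.
  by rewrite -mulr_suml divff.
- by move=> i; apply: Kx.
have scaleE (W : lmodType C) (y : 'I_N -> W) :
    \sum_i lam (lift ord0 i) *: y i
    = (1 - lam ord0) *: \sum_i (lam (lift ord0 i) / s) *: y i.
  rewrite -sE scaler_sumr; apply: eq_bigr => i _.
  by rewrite scalerA mulrCA divff// mulr1.
have le1 : lam ord0 <= 1 by rewrite -lam1 lerDl.
rewrite !scaleE af// -?f1; split=> //.
exact: cK.
Qed.

Lemma convexp_sum (V : lmodType C) (K : V -> Prop) : convexp K ->
  forall N (lam : 'I_N -> C) (x : 'I_N -> V),
    weights lam -> (forall i, K (x i)) -> K (\sum_i lam i *: x i).
Proof.
move=> cK N lam x wl Kx.
have aff_id : affine_on K id by [].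
by have [] := affine_on_sum cK aff_id wl Kx.
Qed.

Lemma weights_inhab N (lam : 'I_N -> C) : weights lam -> exists i, lam i != 0.
Proof.
case=> lam0 lam1; apply/existsP; apply/contraT; rewrite negb_exists => /forallP H.
move: lam1; rewrite big1 => [/eqP|i _]; first by rewrite eq_sym oner_eq0.
by apply/eqP; move: (H i); rewrite negbK.
Qed.

Lemma weights_sum_const (V : lmodType C) N (lam : 'I_N -> C) (x : 'I_N -> V) p :
  weights lam -> (forall i, lam i != 0 -> x i = p) -> \sum_i lam i *: x i = p.
Proof.
move=> [_ lam1] xE; rewrite -[p in RHS]scale1r -lam1 scaler_suml.
apply: eq_bigr => i _; have [->|/xE->//] := eqVneq (lam i) 0.
by rewrite !scale0r.
Qed.

End AffineMaps.

(** * Pure states: spectral decomposition and extremality *)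

Section Pure.
Variables (C : numClosedFieldType).

Definition qf p (A : 'M[C]_p) (v : 'rV[C]_p) : C := (v *m A *m v^t*) 0 0.
Definition ip p (u v : 'rV[C]_p) : C := (u *m v^t*) 0 0.
Definition projv p (x : 'rV[C]_p) : 'M[C]_p := x^t* *m x.
Definition unitv p (x : 'rV[C]_p) : Prop := ip x x = 1.
(** Vectors are rows, so [projv x] with [x] a unit vector is the orthogonal projection onto the line
    of [x]. Extremality in $K_p$ is not built in; it is [pure_extreme]. *)
Definition pure p (A : 'M[C]_p) : Prop := exists2 x : 'rV[C]_p, unitv x & A = projv x.

Section Dim.
Variable p : nat.
Implicit Types (u v x y z a : 'rV[C]_p) (A P w : 'M[C]_p).

Lemma ipE u v : ip u v = \sum_i u 0 i * (v 0 i)^*.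
Proof. by rewrite /ip mxE; apply: eq_bigr => i _; rewrite !mxE. Qed.

Lemma ip_conj u v : ip u v = (ip v u)^*.
Proof.
rewrite !ipE rmorph_sum; apply: eq_bigr => i _.
by rewrite rmorphM /= conjCK mulrC.
Qed.

Lemma ip_addr a u v : ip a (u + v) = ip a u + ip a v.
Proof.
by rewrite !ipE -big_split; apply: eq_bigr => i _; rewrite mxE rmorphD mulrDr.
Qed.

Lemma ip_subr a u v : ip a (u - v) = ip a u - ip a v.
Proof.
by rewrite !ipE -sumrB; apply: eq_bigr => i _; rewrite !mxE rmorphB mulrBr.
Qed.

Lemma ip_scaler a c u : ip a (c *: u) = c^* * ip a u.
Proof.
rewrite !ipE mulr_sumr; apply: eq_bigr => i _.
by rewrite mxE rmorphM mulrCA.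
Qed.

Lemma ip_eq0 v : (ip v v == 0) = (v == 0).
Proof.
apply/eqP/eqP => [|->]; last by rewrite /ip mul0mx mxE.
rewrite ipE => /eqP; rewrite psumr_eq0 => [/allP H|i _]; last exact: mul_conjC_ge0.
apply/rowP=> i; rewrite mxE; apply/eqP; rewrite -mul_conjC_eq0.
by apply: (H i); rewrite mem_index_enum.
Qed.

Lemma ip_ge0 v : 0 <= ip v v.
Proof. by rewrite ipE sumr_ge0// => i _; apply: mul_conjC_ge0. Qed.

Lemma qf_proj v x : qf (projv x) v = `|ip v x| ^+ 2.
Proof.
rewrite /qf /projv mulmxA -mulmxA normCK -ip_conj.
by rewrite [v *m _]mx11_scalar mul_scalar_mx mxE.
Qed.

Lemma qf_sum I (r : seq I) (lam : I -> C) (F : I -> 'M[C]_p) v :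
  qf (\sum_(i <- r) lam i *: F i) v = \sum_(i <- r) lam i * qf (F i) v.
Proof.
rewrite /qf mulmx_sumr mulmx_suml summxE; apply: eq_bigr => i _.
by rewrite -scalemxAr -scalemxAl mxE.
Qed.

Lemma tr_projv x : \tr (projv x) = ip x x.
Proof. by rewrite /projv mxtrace_mulC /mxtrace big_ord1. Qed.

Lemma projv_adj x : (projv x)^t* = projv x.
Proof.
apply/matrixP=> i j; rewrite !mxE rmorph_sum; apply: eq_bigr => k _.
by rewrite !mxE rmorphM /= conjCK mulrC.
Qed.

Lemma pure_state P : pure P -> state P.
Proof.
case=> x ux ->; split; last by rewrite tr_projv.
split; first exact: projv_adj.
by move=> v; rewrite -/(qf _ _) qf_proj exprn_ge0.
Qed.

Lemma pure_tr P : pure P -> \tr P = 1.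
Proof. by move=> /pure_state[]. Qed.

Lemma state_convex : convexp (@state C p).
Proof.
move=> t A B t0 t1 [[hA pA] tA] [[hB pB] tB]; split; last first.
  by rewrite mxtraceD !mxtraceZ tA tB !mulr1 addrC subrK.
have ct (s : C) : 0 <= s -> s^* = s by move=> s0; apply/CrealP/ger0_real.
have s0 : 0 <= 1 - t by rewrite subr_ge0.
split.
  apply/matrixP=> i j; rewrite !mxE rmorphD !rmorphM /= (ct t)// (ct (1 - t))//.
  by move/matrixP/(_ i j): hA; move/matrixP/(_ i j): hB; rewrite !mxE => -> ->.
move=> v; rewrite mulmxDr mulmxDl -!scalemxAr -!scalemxAl mxE.
by rewrite addr_ge0// mxE mulr_ge0.
Qed.

(** The witness is the component of [u] orthogonal to [x]. Were it orthogonal to [u] as well, it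
    would vanish and [u] would be [x] times a phase, which [projv] does not see. *)
Lemma projv_neq u x : unitv u -> unitv x -> projv u != projv x ->
  exists2 a, ip a x = 0 & ip a u != 0.
Proof.
move=> uu ux; pose c := ip u x; pose a := u - c *: x => nux.
have ax : ip a x = 0.
  by rewrite ip_conj ip_subr ip_scaler ux mulr1 -ip_conj subrr conjC0.
exists a => //; apply: contra nux => /eqP au.
have /eqP : ip a a = 0 by rewrite {2}/a ip_subr ip_scaler ax au mulr0 subrr.
rewrite ip_eq0 subr_eq0 => /eqP uE.
have c1 : c * c^* = 1 by rewrite -[RHS]uu {2}uE ip_scaler mulrC.
rewrite uE /projv; apply/eqP/matrixP=> i j; rewrite !mxE; apply: eq_bigr => k _.
by rewrite !mxE rmorphM /= mulrACA [c^* * _]mulrC c1 mul1r.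
Qed.

Lemma projv_eq u x : unitv u -> unitv x ->
  (forall a, ip a x = 0 -> ip a u = 0) -> projv u = projv x.
Proof.
move=> uu ux H; apply/eqP; apply: contraT => /(projv_neq uu ux)[a /H->].
by rewrite eqxx.
Qed.

Lemma projv_normalize z : z != 0 ->
  exists2 u, unitv u & projv z = ip z z *: projv u.
Proof.
move=> z0; have n0 : ip z z != 0 by rewrite ip_eq0.
pose r := sqrtC (ip z z).
have r0 : 0 <= r by rewrite sqrtC_ge0 ip_ge0.
have rr : r * r = ip z z by rewrite -expr2 sqrtCK.
have rn : r != 0 by rewrite sqrtC_eq0.
have cr : (r^-1)^* = r^-1 by apply/CrealP; rewrite ger0_real// invr_ge0.
exists (r^-1 *: z).
  rewrite /unitv ip_scaler cr ip_conj ip_scaler cr rmorphM /= cr -ip_conj -rr.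
  by rewrite mulKf// mulVf.
apply/matrixP=> i j; rewrite !mxE mulr_sumr; apply: eq_bigr => k _.
rewrite !mxE rmorphM /= cr -rr.
by field.
Qed.

(** Spectral theorem: the rows of the diagonalising unitary are orthonormal, each eigenvalue is the
    quadratic form at its row and so nonnegative, and the eigenvalues add up to the trace. That [p]
    terms suffice matters for [affine_iso_dim]. *)
Lemma state_pure_sum w : state w ->
  exists (lam : 'I_p -> C) (P : 'I_p -> 'M[C]_p),
    [/\ weights lam, forall i, pure (P i) & w = \sum_i lam i *: P i].
Proof.
case=> [[hw pw] tw].
have /orthomx_spectralP : w \is normalmx by apply/normalmxP; rewrite hw.
set U := spectralmx w; set d := spectral_diag w => wE.
have Uu : U \is unitarymx by apply: spectral_unitarymx.
have ipU i j : ip (row i U) (row j U) = (i == j)%:R.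
  have /unitarymxP/matrixP/(_ i j) := Uu; rewrite !mxE => <-.
  by rewrite ipE; apply: eq_bigr => k _; rewrite !mxE.
have {}wE : w = \sum_i d 0 i *: projv (row i U).
  rewrite wE invmx_unitary//; apply/matrixP=> i j.
  rewrite summxE !mxE; apply: eq_bigr => k _; rewrite !mxE big_ord1 !mxE.
  rewrite mulrA [d 0 k * _]mulrC; congr (_ * _).
  rewrite (bigD1 k)//= big1 ?addr0 => [|l lk]; rewrite !mxE ?eqxx ?mulr1n//.
  by rewrite (negbTE lk) mulr0n mulr0.
have dE i : d 0 i = qf w (row i U).
  rewrite wE qf_sum (bigD1 i)//= big1 ?addr0 => [|j ji].
    by rewrite qf_proj ipU eqxx normr1 expr1n mulr1.
  by rewrite qf_proj ipU eq_sym (negbTE ji) normr0 expr0n mulr0.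
exists (fun i => d 0 i), (fun i => projv (row i U)); split=> //.
- split=> [i|]; first by rewrite dE; apply: pw.
  rewrite -tw wE raddf_sum /=; apply: eq_bigr => i _.
  by rewrite mxtraceZ tr_projv ipU eqxx mulr1.
- by move=> i; exists (row i U); rewrite // /unitv ipU eqxx.
Qed.

(** At a vector orthogonal to [x] the quadratic form of [P] is zero, hence so is that of every [w i]
    of nonzero weight, being a term of a zero sum of nonnegative numbers. Repeating this on the
    spectral decomposition of [w i] leaves only pure terms equal to [P]. *)
Lemma pure_extreme P N (lam : 'I_N -> C) (w : 'I_N -> 'M[C]_p) :
    pure P -> weights lam -> (forall i, state (w i)) -> P = \sum_i lam i *: w i ->
  forall i, lam i != 0 -> w i = P.
Proof.
case=> x ux PE [lam0 _] sw Psum i li0.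
have wa a : ip a x = 0 -> qf (w i) a = 0.
  move=> ax; have : qf P a = 0 by rewrite PE qf_proj ax normr0 expr0n.
  rewrite Psum qf_sum => /eqP; rewrite psumr_eq0 => [/allP/(_ i)|j _].
    by rewrite mem_index_enum mulf_eq0 (negbTE li0) => /(_ isT)/eqP.
  by rewrite mulr_ge0//; have [[_ psd] _] := sw j; apply: psd.
have [mu [Q [wmu pQ wE]]] := state_pure_sum (sw i).
rewrite wE; apply: weights_sum_const => // j muj.
have [u uu QE] := pQ j; rewrite QE PE; apply: projv_eq => // a /wa.
rewrite wE qf_sum => /eqP; rewrite psumr_eq0 => [/allP/(_ j)|k _].
  rewrite mem_index_enum mulf_eq0 (negbTE muj) QE qf_proj expf_eq0 normr_eq0.
  by move=> /(_ isT)/eqP.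
by rewrite mulr_ge0 ?wmu.1//; have [[_ psd] _] := pure_state (pQ k); apply: psd.
Qed.

(** For $P$, $Q$ the projections on $x$, $y$, the parallelogram identity rewrites their midpoint
    through the normalised projections on $x+y$ and $x-y$. *)
Lemma pure_pair_second_decomposition P Q : pure P -> pure Q -> P <> Q ->
  exists t R S, [/\ 0 < t, t < 1, pure R, pure S
    & [/\ R <> P, R <> Q & 2^-1 *: P + (1 - 2^-1) *: Q = t *: R + (1 - t) *: S]].
Proof.
case=> x ux -> [y uy ->] nPQ.
have sep : ~ (forall a, ip a x = 0 -> ip a y = 0).
  by move=> /(projv_eq uy ux) /esym.
have sep' : ~ (forall a, ip a y = 0 -> ip a x = 0).
  by move=> /(projv_eq ux uy).
have n0 : x + y != 0.
  apply/eqP=> E; apply: sep => a ax; have : ip a (x + y) = 0.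
    by rewrite E /ip trmx0 map_mx0 mulmx0 mxE.
  by rewrite ip_addr ax add0r.
have n1 : x - y != 0.
  rewrite subr_eq0; apply/eqP=> E; apply: sep => a; by rewrite E.
have [u uu Eu] := projv_normalize n0.
have [v uv Ev] := projv_normalize n1.
have h2 : 1 - 2^-1 = 2^-1 :> C by field.
(* The 4 combines the 2 of the parallelogram identity with the 2 of the midpoint; that [t] and [s]
   add up to 1 follows by taking traces. *)
pose t := ip (x + y) (x + y) / 4.
pose s := ip (x - y) (x - y) / 4.
have par : projv (x + y) + projv (x - y) = 2 *: (projv x + projv y).
  apply/matrixP=> i j; rewrite !mxE !big_ord1 !mxE rmorphD rmorphB /=.
  by ring.
have stE : 2^-1 *: projv x + (1 - 2^-1) *: projv y = t *: projv u + s *: projv v.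
  rewrite h2 /t /s ![_ / 4]mulrC -!scalerA -Eu -Ev -!scalerDr par scalerA.
  by congr (_ *: _); field.
have s1 : s = 1 - t.
  move/(congr1 mxtrace): stE; rewrite !mxtraceD !mxtraceZ !tr_projv ux uy uu uv !mulr1.
  by rewrite addrC subrK => ->; rewrite addrC addKr.
have tpos : 0 < t by rewrite divr_gt0 ?ltr0n// lt_def ip_eq0 n0 ip_ge0.
have spos : 0 < s by rewrite divr_gt0 ?ltr0n// lt_def ip_eq0 n1 ip_ge0.
exists t, (projv u), (projv v); split=> //.
- by rewrite -subr_gt0 -s1.
- by exists u.
- by exists v.
(* If [projv u] were the projection on [x], everything orthogonal to [x] would be orthogonal to
   [x + y], hence to [y], against [sep]; symmetrically for [y]. *)
have ipu z a : projv u = projv z -> ip a z = 0 -> ip a (x + y) = 0.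
  move=> E az; have : qf (projv (x + y)) a = 0.
    have := @qf_sum 'I_1 [:: 0] (fun=> ip (x + y) (x + y)) (fun=> projv u) a.
    by rewrite !big_seq1 -Eu E [qf (projv z) a]qf_proj az normr0 expr0n mulr0.
  by rewrite qf_proj => /eqP; rewrite expf_eq0 normr_eq0 => /eqP.
split; last by rewrite -s1.
- move=> E; apply: sep => a ax; have := ipu _ _ E ax.
  by rewrite ip_addr ax add0r.
- move=> E; apply: sep' => a ay; have := ipu _ _ E ay.
  by rewrite ip_addr ay addr0.
Qed.

End Dim.
End Pure.

(** * Kronecker products, partial traces, the swap and separable states *)

Section Kronecker.
Variable C : numClosedFieldType.

Lemma mxvec_index_eq m n (i i' : 'I_m) (k k' : 'I_n) :
  (mxvec_index i k == mxvec_index i' k') = (i == i') && (k == k').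
Proof.
by rewrite /mxvec_index (inj_eq (@cast_ord_inj _ _ _)) (inj_eq enum_rank_inj) xpair_eqE.
Qed.

Lemma mxvec_matrixP m n (X Y : 'M[C]_(m * n)) :
  (forall i k j l, X (mxvec_index i k) (mxvec_index j l)
                   = Y (mxvec_index i k) (mxvec_index j l)) -> X = Y.
Proof.
by move=> H; apply/matrixP=> a b; case/mxvec_indexP: a => i k; case/mxvec_indexP: b.
Qed.

Lemma kronmxE m n (A : 'M[C]_m) (B : 'M[C]_n) i k j l :
  kronmx A B (mxvec_index i k) (mxvec_index j l) = A i j * B k l.
Proof.
rewrite /kronmx summxE (bigD1 i)//= [X in _ + X]big1 ?addr0 => [|i' ni].
  rewrite summxE (bigD1 j)//= [X in _ + X]big1 ?addr0 => [|j' nj].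
    rewrite summxE (bigD1 k)//= [X in _ + X]big1 ?addr0 => [|k' nk].
      rewrite summxE (bigD1 l)//= [X in _ + X]big1 ?addr0 => [|l' nl].
        by rewrite !mxE !eqxx mulr1.
      by rewrite !mxE !mxvec_index_eq (eq_sym l) (negbTE nl) !andbF mulr0.
    rewrite summxE big1// => l' _.
    by rewrite !mxE !mxvec_index_eq (eq_sym k) (negbTE nk) !andbF mulr0.
  rewrite summxE big1// => k' _; rewrite summxE big1// => l' _.
  by rewrite !mxE !mxvec_index_eq (eq_sym j) (negbTE nj) !andbF mulr0.
rewrite summxE big1// => j' _; rewrite summxE big1// => k' _; rewrite summxE big1// => l' _.
by rewrite !mxE !mxvec_index_eq (eq_sym i) (negbTE ni) mulr0.
Qed.

Lemma kronmx_suml m n I (r : seq I) (lam : I -> C) (F : I -> 'M[C]_m) (B : 'M[C]_n) :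
  kronmx (\sum_(i <- r) lam i *: F i) B = \sum_(i <- r) lam i *: kronmx (F i) B.
Proof.
apply: mxvec_matrixP => i k j l; rewrite kronmxE !summxE mulr_suml.
by apply: eq_bigr => q _; rewrite !mxE kronmxE mulrA.
Qed.

Lemma kronmx_sumr m n I (r : seq I) (lam : I -> C) (A : 'M[C]_m) (F : I -> 'M[C]_n) :
  kronmx A (\sum_(i <- r) lam i *: F i) = \sum_(i <- r) lam i *: kronmx A (F i).
Proof.
apply: mxvec_matrixP => i k j l; rewrite kronmxE !summxE mulr_sumr.
by apply: eq_bigr => q _; rewrite !mxE kronmxE mulrCA.
Qed.

Lemma kronmx_combl m n (s t : C) (A A' : 'M[C]_m) (B : 'M[C]_n) :
  kronmx (s *: A + t *: A') B = s *: kronmx A B + t *: kronmx A' B.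
Proof.
by apply: mxvec_matrixP => i k j l; rewrite !(kronmxE, mxE) mulrDl !mulrA.
Qed.

Lemma kronmx_combr m n (s t : C) (A : 'M[C]_m) (B B' : 'M[C]_n) :
  kronmx A (s *: B + t *: B') = s *: kronmx A B + t *: kronmx A B'.
Proof.
by apply: mxvec_matrixP => i k j l; rewrite !(kronmxE, mxE) mulrDr !(mulrCA (A i j)).
Qed.

(** Partial traces: [ptr1] traces out the second factor, [ptr2] the first. They recover the factors
    of a product state. *)
Definition ptr1 m n (X : 'M[C]_(m * n)) : 'M[C]_m :=
  \matrix_(i, j) \sum_k X (mxvec_index i k) (mxvec_index j k).
Definition ptr2 m n (X : 'M[C]_(m * n)) : 'M[C]_n :=
  \matrix_(k, l) \sum_i X (mxvec_index i k) (mxvec_index i l).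

Lemma ptr1_kron m n (A : 'M[C]_m) (B : 'M[C]_n) : \tr B = 1 -> ptr1 (kronmx A B) = A.
Proof.
move=> tB; apply/matrixP=> i j; rewrite mxE.
by under eq_bigr do rewrite kronmxE; rewrite -mulr_sumr -/(\tr B) tB mulr1.
Qed.

Lemma ptr2_kron m n (A : 'M[C]_m) (B : 'M[C]_n) : \tr A = 1 -> ptr2 (kronmx A B) = B.
Proof.
move=> tA; apply/matrixP=> i j; rewrite mxE.
by under eq_bigr do rewrite kronmxE; rewrite -mulr_suml -/(\tr A) tA mul1r.
Qed.

Lemma ptr1_is_linear m n : linear (@ptr1 m n).
Proof.
move=> a X Y; apply/matrixP=> i j; rewrite !mxE mulr_sumr -big_split /=.
by apply: eq_bigr => k _; rewrite !mxE.
Qed.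
HB.instance Definition _ m n :=
  GRing.isLinear.Build C 'M[C]_(m * n) 'M[C]_m _ (@ptr1 m n) (@ptr1_is_linear m n).

Lemma ptr2_is_linear m n : linear (@ptr2 m n).
Proof.
move=> a X Y; apply/matrixP=> i j; rewrite !mxE mulr_sumr -big_split /=.
by apply: eq_bigr => k _; rewrite !mxE.
Qed.
HB.instance Definition _ m n :=
  GRing.isLinear.Build C 'M[C]_(m * n) 'M[C]_n _ (@ptr2 m n) (@ptr2_is_linear m n).

(** The basis permutation behind the swap, for arbitrary [m] and [n], so that $S_{m,n}$ and
    $S_{n,m}$ can be compared even when the dimensions differ. *)
Definition swapi m n (a : 'I_(n * m)) : 'I_(m * n) :=
  let: p := enum_val (cast_ord (esym (mxvec_cast n m)) a) in mxvec_index p.2 p.1.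
Definition swapmx m n (X : 'M[C]_(m * n)) : 'M[C]_(n * m) :=
  mxsub (@swapi m n) (@swapi m n) X.

Lemma swapiE m n (k : 'I_n) (i : 'I_m) : swapi (mxvec_index k i) = mxvec_index i k.
Proof. by rewrite /swapi cast_ordK enum_rankK. Qed.

Lemma swapmx_kron m n (A : 'M[C]_m) (B : 'M[C]_n) :
  swapmx (kronmx A B) = kronmx B A.
Proof.
by apply: mxvec_matrixP => i k j l; rewrite mxE !swapiE !kronmxE mulrC.
Qed.

Lemma swapmxK m n : cancel (@swapmx m n) (@swapmx n m).
Proof. by move=> X; apply: mxvec_matrixP => i k j l; rewrite 2!mxE !swapiE. Qed.

Lemma swapmx_is_linear m n : linear (@swapmx m n).
Proof. by move=> a X Y; apply/matrixP=> i j; rewrite !mxE. Qed.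
HB.instance Definition _ m n :=
  GRing.isLinear.Build C 'M[C]_(m * n) 'M[C]_(n * m) _ (@swapmx m n) (@swapmx_is_linear m n).

Lemma separable_swap m n (X : 'M[C]_(m * n)) : separable X -> separable (swapmx X).
Proof.
case=> N [lam [w [s [l0 [l1 [sw [ss ->]]]]]]].
exists N, lam, s, w; do 4!split=> //.
rewrite linear_sum; apply: eq_bigr => i _.
by rewrite linearZ /= swapmx_kron.
Qed.

Lemma kron_separable m n (A : 'M[C]_m) (B : 'M[C]_n) :
  state A -> state B -> separable (kronmx A B).
Proof.
move=> sA sB; exists 1%N, (fun=> 1), (fun=> A), (fun=> B).
by rewrite !big_ord1 scale1r; do 4!split=> //; rewrite ler01.
Qed.

Lemma separable_convex m n : convexp (@separable C m n).
Proof.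
move=> t X Y t0 t1 [N [lam [w [s [l0 [l1 [sw [ss ->]]]]]]]].
case=> N' [mu [w' [s' [m0 [m1 [sw' [ss' ->]]]]]]].
exists (N + N')%N,
  (fun i => match split i with inl a => t * lam a | inr b => (1 - t) * mu b end),
  (fun i => match split i with inl a => w a | inr b => w' b end),
  (fun i => match split i with inl a => s a | inr b => s' b end).
have eL (i : 'I_N) : split (lshift N' i) = inl i := unsplitK (inl i).
have eR (i : 'I_N') : split (rshift N i) = inr i := unsplitK (inr i).
have t10 : 0 <= 1 - t by rewrite subr_ge0.
split; first by move=> i; case: split => a; rewrite mulr_ge0.
split.
  rewrite big_split_ord /=; under eq_bigr do rewrite eL.
  under [X in _ + X]eq_bigr do rewrite eR.
  by rewrite -!mulr_sumr l1 m1 !mulr1 addrC subrK.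
split; first by move=> i; case: split.
split; first by move=> i; case: split.
rewrite big_split_ord /=; under [in RHS]eq_bigr do rewrite eL.
under [X in _ = _ + X]eq_bigr do rewrite eR.
by rewrite !scaler_sumr; congr (_ + _); apply: eq_bigr => i _; rewrite scalerA.
Qed.

Definition pprod m n (X : 'M[C]_(m * n)) : Prop :=
  exists P Q, [/\ pure P, pure Q & X = kronmx P Q].

Lemma pprod_separable m n (X : 'M[C]_(m * n)) : pprod X -> separable X.
Proof. by case=> P [Q [/pure_state sP /pure_state sQ ->]]; apply: kron_separable. Qed.

Lemma ptr1_state m n (X : 'M[C]_(m * n)) : separable X -> state (ptr1 X).
Proof.
case=> N [lam [w [s [l0 [l1 [sw [ss ->]]]]]]]; rewrite linear_sum /=.
under eq_bigr do rewrite linearZ /= ptr1_kron ?(ss _).2//.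
by apply: convexp_sum => //; apply: state_convex.
Qed.

Lemma ptr2_state m n (X : 'M[C]_(m * n)) : separable X -> state (ptr2 X).
Proof.
case=> N [lam [w [s [l0 [l1 [sw [ss ->]]]]]]]; rewrite linear_sum /=.
under eq_bigr do rewrite linearZ /= ptr2_kron ?(sw _).2//.
by apply: convexp_sum => //; apply: state_convex.
Qed.

(** The marginals are convex combinations of the [w i] and of the [s i] with the same weights, so
    their purity forces every factor of nonzero weight to be [P], respectively [Q]. *)
Lemma separable_pure_marginals m n (X : 'M[C]_(m * n)) P Q :
  separable X -> pure P -> pure Q -> ptr1 X = P -> ptr2 X = Q -> X = kronmx P Q.
Proof.
case=> N [lam [w [s [l0 [l1 [sw [ss XE]]]]]]] pP pQ.
rewrite {1 2}XE !linear_sum /=.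
under eq_bigr do rewrite linearZ /= ptr1_kron ?(ss _).2//.
move=> /esym PE.
under eq_bigr do rewrite linearZ /= ptr2_kron ?(sw _).2//.
move=> /esym QE; rewrite XE; apply: weights_sum_const => // i li.
by rewrite (pure_extreme pP _ sw PE)// (pure_extreme pQ _ ss QE).
Qed.

(** Partial traces carry the decomposition to the pure factors of [X], where [pure_extreme] fixes
    both marginals of each [Y i] of nonzero weight; pure marginals then determine [Y i]. *)
Lemma pprod_extreme m n (X : 'M[C]_(m * n)) N (lam : 'I_N -> C) (Y : 'I_N -> 'M[C]_(m * n)) :
    pprod X -> weights lam -> (forall i, separable (Y i)) -> X = \sum_i lam i *: Y i ->
  forall i, lam i != 0 -> Y i = X.
Proof.
case=> P [Q [pP pQ ->]] wl sY E i li.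
apply: separable_pure_marginals => //.
- apply: (pure_extreme pP wl (w := fun i => ptr1 (Y i))) => // [j|].
    exact: ptr1_state.
  rewrite -[LHS](ptr1_kron P (pure_tr pQ)) E linear_sum.
  by apply: eq_bigr => j _; rewrite linearZ.
- apply: (pure_extreme pQ wl (w := fun i => ptr2 (Y i))) => // [j|].
    exact: ptr2_state.
  rewrite -[LHS](ptr2_kron Q (pure_tr pP)) E linear_sum.
  by apply: eq_bigr => j _; rewrite linearZ.
Qed.

Lemma separable_pprod_sum m n (X : 'M[C]_(m * n)) : separable X ->
  exists N (lam : 'I_N -> C) (Y : 'I_N -> 'M[C]_(m * n)),
    [/\ weights lam, forall i, pprod (Y i) & X = \sum_i lam i *: Y i].
Proof.
case=> N [lam [w [s [l0 [l1 [sw [ss ->]]]]]]].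
have /fin_all_exists[mu /fin_all_exists[P wP]] := fun i => state_pure_sum (sw i).
have /fin_all_exists[nu /fin_all_exists[Q sQ]] := fun i => state_pure_sum (ss i).
(* Both factors of each term are decomposed spectrally, so the new terms are indexed by triples,
   enumerated as one ordinal. *)
pose T := ('I_N * ('I_m * 'I_n))%type.
pose f (t : T) := lam t.1 * (mu t.1 t.2.1 * nu t.1 t.2.2).
pose Y (t : T) := kronmx (P t.1 t.2.1) (Q t.1 t.2.2).
exists #|{: T}|, (fun a => f (enum_val a)), (fun a => Y (enum_val a)).
have sumT (V : nmodType) (F : T -> V) :
    \sum_(a < #|{: T}|) F (enum_val a) = \sum_i \sum_k \sum_l F (i, (k, l)).
  transitivity (\sum_t F t).
    by rewrite [RHS](reindex _ (onW_bij _ (@enum_val_bij T))).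
  under [RHS]eq_bigr do rewrite pair_bigA.
  by rewrite pair_bigA; apply: eq_bigr => -[i [k l]].
split.
- split=> [a|].
    by rewrite /f !mulr_ge0//; [have [[]] := wP (enum_val a).1 | have [[]] := sQ (enum_val a).1].
  rewrite sumT -l1; apply: eq_bigr => i _; rewrite /f /=.
  have [[_ mu1] _ _] := wP i; have [[_ nu1] _ _] := sQ i.
  under eq_bigr do rewrite -!mulr_sumr nu1 mulr1.
  by rewrite -mulr_sumr mu1 mulr1.
- move=> a; exists (P (enum_val a).1 (enum_val a).2.1), (Q (enum_val a).1 (enum_val a).2.2).
  by have [_ pP _] := wP (enum_val a).1; have [_ pQ _] := sQ (enum_val a).1.
- rewrite (sumT _ (fun t => f t *: Y t)); apply: eq_bigr => i _.
  have [_ _ ->] := wP i; have [_ _ ->] := sQ i.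
  rewrite kronmx_suml scaler_sumr; apply: eq_bigr => k _.
  rewrite kronmx_sumr !scaler_sumr; apply: eq_bigr => l _.
  by rewrite !scalerA /f mulrA.
Qed.

(* [mxvec (a^T *m b)] is the product vector [a (x) b]. *)
Definition qprod m n (X : 'M[C]_(m * n)) (a : 'rV[C]_m) (b : 'rV[C]_n) : C :=
  qf X (mxvec (a^T *m b)).

Lemma qprod_kron m n (A : 'M[C]_m) (B : 'M[C]_n) a b :
  qprod (kronmx A B) a b = qf A a * qf B b.
Proof.
have qfE p (M : 'M[C]_p) v : qf M v = \sum_i \sum_j v 0 i * M i j * (v 0 j)^*.
  rewrite /qf mxE exchange_big /=; apply: eq_bigr => j _.
  by rewrite !mxE mulr_suml; apply: eq_bigr.
have vE i k : mxvec (a^T *m b) 0 (mxvec_index i k) = a 0 i * b 0 k.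
  by rewrite mxvecE mxE big_ord1 !mxE.
have sumE (F : 'I_(m * n) -> C) : \sum_q F q = \sum_i \sum_k F (mxvec_index i k).
  by rewrite (reindex _ (curry_mxvec_bij _ _)) pair_bigA; apply: eq_bigr => -[].
rewrite /qprod !qfE sumE mulr_suml; apply: eq_bigr => i _.
rewrite mulr_sumr; apply: eq_bigr => k _.
rewrite sumE mulr_suml; apply: eq_bigr => j _.
rewrite mulr_sumr; apply: eq_bigr => l _.
by rewrite !vE kronmxE rmorphM /=; ring.
Qed.

Lemma qprod_sep_ge0 m n (X : 'M[C]_(m * n)) a b : separable X -> 0 <= qprod X a b.
Proof.
case=> N [lam [w [s [l0 [l1 [sw [ss ->]]]]]]].
rewrite /qprod qf_sum sumr_ge0// => i _; rewrite mulr_ge0//.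
rewrite -/(qprod _ a b) qprod_kron mulr_ge0//.
- by have [[_ psd] _] := sw i; apply: psd.
- by have [[_ psd] _] := ss i; apply: psd.
Qed.

(** The adjacency of the rook graph in convex terms: it is invariant under affine isomorphisms, and
    for distinct pure product states it amounts to sharing a factor. *)
Definition midpoint_splits m n (X Y : 'M[C]_(m * n)) : Prop :=
  exists t R S, [/\ 0 < t, t < 1, pprod R, pprod S
    & [/\ R <> X, R <> Y & 2^-1 *: X + (1 - 2^-1) *: Y = t *: R + (1 - t) *: S]].

Lemma midpoint_splits_sharel m n (P : 'M[C]_m) (Q Q' : 'M[C]_n) :
  pure P -> pure Q -> pure Q' -> Q <> Q' ->
  midpoint_splits (kronmx P Q) (kronmx P Q').
Proof.
move=> pP pQ pQ' nQ.
have [t [R [S [t0 t1 pR pS [RQ RQ' E]]]]] := pure_pair_second_decomposition pQ pQ' nQ.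
exists t, (kronmx P R), (kronmx P S); split=> //; [by exists P, R|by exists P, S|].
split; last by rewrite -!kronmx_combr E.
- by move/(congr1 (@ptr2 m n)); rewrite !ptr2_kron// pure_tr.
- by move/(congr1 (@ptr2 m n)); rewrite !ptr2_kron// pure_tr.
Qed.

Lemma midpoint_splits_sharer m n (P P' : 'M[C]_m) (Q : 'M[C]_n) :
  pure P -> pure P' -> pure Q -> P <> P' ->
  midpoint_splits (kronmx P Q) (kronmx P' Q).
Proof.
move=> pP pP' pQ nP.
have [t [R [S [t0 t1 pR pS [RP RP' E]]]]] := pure_pair_second_decomposition pP pP' nP.
exists t, (kronmx R Q), (kronmx S Q); split=> //; [by exists R, Q|by exists S, Q|].
split; last by rewrite -!kronmx_combl E.
- by move/(congr1 (@ptr1 m n)); rewrite !ptr1_kron// pure_tr.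
- by move/(congr1 (@ptr1 m n)); rewrite !ptr1_kron// pure_tr.
Qed.

(* A product vector [a (x) b] with [a] orthogonal to [x] and [b] orthogonal to
   [y'] is orthogonal to both [x (x) y] and [x' (x) y'], hence to every product
   vector in their span. *)
Lemma midpoint_splits_share m n (P P' : 'M[C]_m) (Q Q' : 'M[C]_n) :
  pure P -> pure P' -> pure Q -> pure Q' ->
  midpoint_splits (kronmx P Q) (kronmx P' Q') -> P = P' \/ Q = Q'.
Proof.
case=> x ux -> [x' ux' ->] [y uy ->] [y' uy' ->].
case=> t [_ [S [t0 t1 [_ [_ [[u uu ->] [v uv ->] ->]]] pS [RX RY E]]]].
have vanish a b : ip a x * ip b y = 0 -> ip a x' * ip b y' = 0 -> ip a u * ip b v = 0.
  move=> e1 e2.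
  have q1 (z : 'rV[C]_m) (z' : 'rV[C]_n) :
      qprod (kronmx (projv z) (projv z')) a b = `|ip a z * ip b z'| ^+ 2.
    by rewrite qprod_kron !qf_proj normrM exprMn.
  have qD c d (X Y : 'M[C]_(m * n)) :
      qprod (c *: X + d *: Y) a b = c * qprod X a b + d * qprod Y a b.
    by rewrite /qprod /qf mulmxDr mulmxDl -!scalemxAr -!scalemxAl !mxE.
  move/(congr1 (fun X => qprod X a b)): E.
  rewrite !qD !q1 e1 e2 normr0 expr0n !mulr0 addr0 => /esym/eqP.
  have S0 : 0 <= qprod S a b by apply/qprod_sep_ge0/pprod_separable.
  have t0' := ltW t0; have t1' : 0 <= 1 - t by rewrite subr_ge0 ltW.
  rewrite paddr_eq0 ?mulr_ge0 ?exprn_ge0//.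
  by rewrite mulf_eq0 gt_eqF//= expf_eq0 normr_eq0 => /andP[/eqP].
have either (z : 'rV[C]_m) (z' : 'rV[C]_n) : unitv z -> unitv z' ->
    (forall a b, ip a z = 0 -> ip b z' = 0 -> ip a u * ip b v = 0) ->
    projv u = projv z \/ projv v = projv z'.
  move=> uz uz' H.
  have [|nu] := eqVneq (projv u) (projv z); first by left.
  have [|nv] := eqVneq (projv v) (projv z'); first by right.
  have [a az au] := projv_neq uu uz nu; have [b bz bv] := projv_neq uv uz' nv.
  by move/eqP: (H a b az bz); rewrite mulf_eq0 (negbTE au) (negbTE bv).
(* The alternative is applied to the crossed pairs [(x, y')] and [(x', y)]. Two answers in the same
   factor show that this factor is shared; mixed answers would make the new product state one of the
   two given ones. *)
have [a b ax by'|ux1|vy1] := either x y' ux uy'.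
- by apply: vanish; rewrite ?ax ?by' ?mul0r ?mulr0.
- have [a b ax by'|ux2|vy2] := either x' y ux' uy.
  + by apply: vanish; rewrite ?ax ?by' ?mul0r ?mulr0.
  + by left; rewrite -ux1 -ux2.
  + by case: RX; rewrite ux1 vy2.
- have [a b ax by'|ux2|vy2] := either x' y ux' uy.
  + by apply: vanish; rewrite ?ax ?by' ?mul0r ?mulr0.
  + by case: RY; rewrite ux2 vy1.
  + by right; rewrite -vy1 -vy2.
Qed.

End Kronecker.

(* [(x, y) |-> (f x y, g x y)] as a map of rook graphs: vertices are pairs, and two pairs are
   adjacent when they share a coordinate. *)
Section Rook.
Variables (T U T' U' : eqType) (A : T -> Prop) (B : U -> Prop).
Variables (f : T -> U -> T') (g : T -> U -> U').
Hypothesis fg_inj : forall x x' y y', A x -> A x' -> B y -> B y' ->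
  f x y = f x' y' -> g x y = g x' y' -> x = x' /\ y = y'.
Hypothesis row : forall x y y', A x -> B y -> B y' ->
  f x y = f x y' \/ g x y = g x y'.
Hypothesis col : forall x x' y, A x -> A x' -> B y ->
  f x y = f x' y \/ g x y = g x' y.
Hypothesis diag : forall x x' y y', A x -> A x' -> B y -> B y' -> x <> x' -> y <> y' ->
  f x y <> f x' y' /\ g x y <> g x' y'.

(** If the row edge and the column edge at [(x, y)] kept the same coordinate, the images of
    [(x, y')] and [(x', y)] would agree in it, against [diag]. *)
Lemma rook_corner x x' y y' : A x -> A x' -> B y -> B y' -> x <> x' -> y <> y' ->
  (f x y = f x y' /\ g x y = g x' y) \/ (g x y = g x y' /\ f x y = f x' y).
Proof.
move=> Ax Ax' By By' nx ny.
have [nf ng] := diag Ax Ax' By' By nx (fun e => ny (esym e)).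
have [fr|gr] := row Ax By By'; have [fc|gc] := col Ax Ax' By.
- by case: nf; rewrite -fr -fc.
- by left.
- by right.
- by case: ng; rewrite -gr -gc.
Qed.

Let straight_at x y :=
  (forall y', B y' -> f x y = f x y') /\ (forall x', A x' -> g x y = g x' y).
Let swapped_at x y :=
  (forall y', B y' -> g x y = g x y') /\ (forall x', A x' -> f x y = f x' y).

(** One corner fixes the type at [(x, y)]. A second corner sharing an edge with it but of the other
    type would preserve both coordinates along that edge, against injectivity. *)
Lemma rook_at x x' y y' : A x -> A x' -> B y -> B y' -> x <> x' -> y <> y' ->
  straight_at x y \/ swapped_at x y.
Proof.
move=> Ax Ax' By By' nx ny.
have [[fe ge]|[ge fe]] := rook_corner Ax Ax' By By' nx ny; [left|right].
- split=> [z Bz|z Az].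
    have [<-//|/eqP yz] := eqVneq y z.
    have [[]//|[_ fe']] := rook_corner Ax Ax' By Bz nx yz.
    by have [] := fg_inj Ax Ax' By By fe' ge.
  have [<-//|/eqP xz] := eqVneq x z.
  have [[]//|[ge' _]] := rook_corner Ax Az By By' xz ny.
  by have [] := fg_inj Ax Ax By By' fe ge'.
- split=> [z Bz|z Az].
    have [<-//|/eqP yz] := eqVneq y z.
    have [[_ ge']|[]//] := rook_corner Ax Ax' By Bz nx yz.
    by have [] := fg_inj Ax Ax' By By fe ge'.
  have [<-//|/eqP xz] := eqVneq x z.
  have [[fe' _]|[]//] := rook_corner Ax Az By By' xz ny.
  by have [] := fg_inj Ax Ax By By' fe' ge.
Qed.

(** Adjacent vertices have the same type, since opposite types would give them equal images. The
    type at [(x0, y0)] spreads first to [(x, y0)], then to [(x, y)]. *)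
Lemma rook_automorphism x0 x1 y0 y1 : A x0 -> A x1 -> x0 <> x1 -> B y0 -> B y1 -> y0 <> y1 ->
  (forall x y, A x -> B y -> straight_at x y) \/ (forall x y, A x -> B y -> swapped_at x y).
Proof.
move=> Ax0 Ax1 nx By0 By1 ny.
have otherx x : A x -> exists2 x', A x' & x <> x'.
  by move=> _; have [->|/eqP] := eqVneq x x0; [exists x1 | exists x0].
have othery y : B y -> exists2 y', B y' & y <> y'.
  by move=> _; have [->|/eqP] := eqVneq y y0; [exists y1 | exists y0].
have kind x y : A x -> B y -> straight_at x y \/ swapped_at x y.
  move=> Ax By; have [x' Ax' xx'] := otherx x Ax; have [y' By' yy'] := othery y By.
  exact: rook_at Ax Ax' By By' xx' yy'.
have st_sw_row x y y' : A x -> B y -> B y' -> y <> y' ->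
    straight_at x y -> swapped_at x y' -> False.
  move=> Ax By By' ny' [S _] [W _].
  by have [] := fg_inj Ax Ax By By' (S _ By') (esym (W _ By)).
have st_sw_col x x' y : A x -> A x' -> B y -> x <> x' ->
    straight_at x y -> swapped_at x' y -> False.
  move=> Ax Ax' By nx' [_ S] [_ W].
  by have [] := fg_inj Ax Ax' By By (esym (W _ Ax)) (S _ Ax').
have [S|W] := kind _ _ Ax0 By0; [left|right] => x y Ax By.
  have Sx : straight_at x y0.
    have [<-//|/eqP xx] := eqVneq x0 x.
    by have [//|/(st_sw_col _ _ _ Ax0 Ax By0 xx S)] := kind _ _ Ax By0.
  have [<-//|/eqP yy] := eqVneq y0 y.
  by have [//|/(st_sw_row _ _ _ Ax By0 By yy Sx)] := kind _ _ Ax By.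
have Wx : swapped_at x y0.
  have [->//|/eqP xx] := eqVneq x x0.
  by have [/st_sw_col/(_ W)[]|//] := kind _ _ Ax By0.
have [->//|/eqP yy] := eqVneq y y0.
by have [/st_sw_row/(_ Wx)[]|//] := kind _ _ Ax By.
Qed.

End Rook.

(** * Affine isomorphisms of state spaces and dimension *)

Section StateIso.
Variable C : numClosedFieldType.

Lemma pure_delta p (i : 'I_p) : pure (delta_mx i i : 'M[C]_p).
Proof.
exists (delta_mx 0 i : 'rV[C]_p).
  rewrite /unitv ipE (bigD1 i)//= big1 ?addr0 => [|j ji].
    by rewrite mxE !eqxx mul1r conjC1.
  by rewrite !mxE (negbTE ji) mul0r.
apply/matrixP=> j k; rewrite !mxE big_ord1 !mxE eqxx /= rmorph_nat.
by rewrite -natrM mulnb.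
Qed.

Lemma two_pure p : (1 < p)%N -> exists P Q : 'M[C]_p, [/\ pure P, pure Q & P <> Q].
Proof.
case: p => [|[|p]] // _.
exists (delta_mx 0 0), (delta_mx 1 1); split; try exact: pure_delta.
by move/matrixP/(_ 0 0)/eqP; rewrite !mxE !eqxx oner_eq0.
Qed.

Lemma state_dim1 p (A B : 'M[C]_p) : (p <= 1)%N -> state A -> state B -> A = B.
Proof.
case: p A B => [|[|//]] A B _ [_ tA] [_ tB]; first by rewrite [A]flatmx0 [B]flatmx0.
move: tA tB; rewrite /mxtrace !big_ord1 => tA tB.
by rewrite [A]mx11_scalar [B]mx11_scalar tA tB.
Qed.

Lemma rank_pure_sum p q (lam : 'I_q -> C) (P : 'I_q -> 'M[C]_p) :
  (forall i, pure (P i)) -> (\rank (\sum_i lam i *: P i)%R <= q)%N.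
Proof.
move=> pP; rewrite -[leqRHS]card_ord -sum1_card.
elim/big_ind2: _ => [|A a B b Aa Bb|i _]; first by rewrite mxrank0.
- exact: leq_trans (mxrank_add _ _) (leq_add Aa Bb).
- have [x _ ->] := pP i; rewrite /projv scalemxAl.
  by apply: leq_trans (mxrankM_maxl _ _) _; apply: rank_leq_col.
Qed.

Lemma max_mixed_state p : (0 < p)%N -> state (p%:R^-1%:M : 'M[C]_p).
Proof.
move=> p0; have pN : p%:R != 0 :> C by rewrite pnatr_eq0 -lt0n.
have pinv : 0 <= p%:R^-1 :> C by rewrite invr_ge0 ler0n.
split; last by rewrite mxtrace_scalar -(mulr_natr p%:R^-1) mulVf.
split; first by rewrite tr_scalar_mx map_scalar_mx /= (CrealP (ger0_real pinv)).
move=> v; rewrite mul_mx_scalar -scalemxAl mxE mulr_ge0//; exact: ip_ge0.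
Qed.

Section FromPure.
Variables (p q : nat) (psi : 'M[C]_p -> 'M[C]_q).
Hypothesis psi_aff : affine_on (@state C p) psi.
Hypothesis psi_inj : forall w w', state w -> state w' -> psi w = psi w' -> w = w'.
Hypothesis psi_pure : forall P, pure P -> pure (psi P).
Hypothesis psi_preim : forall R, pure R -> exists2 P, pure P & psi P = R.

(** Every state is a convex combination of pure ones, so range and surjectivity need checking only
    on pure states. *)
Lemma affine_iso_of_pure : affine_iso (@state C p) (@state C q) psi.
Proof.
split=> //.
  move=> w /state_pure_sum[lam [P [wl pP ->]]].
  have [|_ ->] := affine_on_sum (@state_convex C p) psi_aff wl (x := P).
    by move=> i; apply: pure_state.
  apply: convexp_sum => //; first exact: state_convex.
  by move=> i; apply/pure_state/psi_pure.
move=> y /state_pure_sum[lam [R [wl pR ->]]].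
have /fin_all_exists2[P pP PR] := fun i => psi_preim (pR i).
have [|sw E] := affine_on_sum (@state_convex C p) psi_aff wl (x := P).
  by move=> i; apply: pure_state.
by exists (\sum_i lam i *: P i) => //; rewrite E; apply: eq_bigr => i _; rewrite PR.
Qed.

(* The maximally mixed state of [C^p] has rank [p], while its image, hence
   itself, is a convex combination of [q] pure states. *)
Lemma affine_iso_dim : (0 < p)%N -> (p <= q)%N.
Proof.
move=> p0; have sI := max_mixed_state p0.
have [psi_st _ _ _] := affine_iso_of_pure.
have [lam [R [wl pR E]]] := state_pure_sum (psi_st _ sI).
have /fin_all_exists2[P pP PR] := fun i => psi_preim (pR i).
have [|sw E'] := affine_on_sum (@state_convex C p) psi_aff wl (x := P).
  by move=> i; apply: pure_state.
have := rank_pure_sum lam pP; rewrite -(psi_inj sI sw).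
  by rewrite -scalemx1 mxrank_scale_nz ?mxrank1// invr_eq0 pnatr_eq0 -lt0n.
by rewrite E E'; apply: eq_bigr => i _; rewrite PR.
Qed.

End FromPure.
End StateIso.

(** * Affine isomorphisms of separable state spaces *)

Section SeparableIso.
Variable C : numClosedFieldType.

Section Rectangular.
Variables (m n m' n' : nat) (Phi : 'M[C]_(m * n) -> 'M[C]_(m' * n')).
Hypothesis Phi_iso : affine_iso (@separable C m n) (@separable C m' n') Phi.

(** Pull a decomposition of [Phi X] into pure products back to one of [X]; extremality of [X] makes
    some preimage [Z i] equal to [X], so [Phi X] is one of the pure products. *)
Lemma iso_pprod X : pprod X -> pprod (Phi X).
Proof.
have [Phi_sep Phi_inj Phi_surj Phi_aff] := Phi_iso.
move=> pX; have sX := pprod_separable pX.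
have [N [lam [Y [wl pY E]]]] := separable_pprod_sum (Phi_sep _ sX).
have /fin_all_exists2[Z sZ ZE] := fun i => Phi_surj _ (pprod_separable (pY i)).
have [sS SE] := affine_on_sum (@separable_convex C m n) Phi_aff wl sZ.
have XE : X = \sum_i lam i *: Z i.
  by apply: Phi_inj => //; rewrite SE E; apply: eq_bigr => i _; rewrite ZE.
have [i li] := weights_inhab wl.
by rewrite -(pprod_extreme pX wl sZ XE li) ZE.
Qed.

(** Here the preimage of [Y] is decomposed, and extremality of [Y] shows that some pure product in
    it is already sent to [Y]. *)
Lemma iso_pprod_preim Y : pprod Y -> exists2 X, pprod X & Phi X = Y.
Proof.
have [Phi_sep Phi_inj Phi_surj Phi_aff] := Phi_iso.
move=> pY; have [X sX XY] := Phi_surj _ (pprod_separable pY).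
have [N [lam [Z [wl pZ E]]]] := separable_pprod_sum sX.
have [|_ SE] := affine_on_sum (@separable_convex C m n) Phi_aff wl (x := Z).
  by move=> i; apply: pprod_separable.
have [i li] := weights_inhab wl; exists (Z i) => //.
rewrite E SE in XY.
apply: (pprod_extreme pY wl (Y := fun i => Phi (Z i))) => // j.
exact/Phi_sep/pprod_separable.
Qed.

Lemma iso_midpoint_splits X Y : pprod X -> pprod Y ->
  midpoint_splits X Y <-> midpoint_splits (Phi X) (Phi Y).
Proof.
have [Phi_sep Phi_inj Phi_surj Phi_aff] := Phi_iso => pX pY.
have sX := pprod_separable pX; have sY := pprod_separable pY.
have h0 : 0 <= 2^-1 :> C by rewrite invr_ge0 ler0n.
have h1 : 2^-1 <= 1 :> C by rewrite invf_le1 ?ler1n ?ltr0n.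
split=> [[t [R [S [t0 t1 pR pS [RX RY E]]]]]|].
  have sR := pprod_separable pR; have sS := pprod_separable pS.
  exists t, (Phi R), (Phi S); split=> //; try exact: iso_pprod.
  split; try by move/Phi_inj; auto.
  by rewrite -!Phi_aff ?E ?(ltW t0) ?(ltW t1).
case=> t [_ [_ [t0 t1 /iso_pprod_preim[R pR <-] /iso_pprod_preim[S pS <-] [RX RY E]]]].
have sR := pprod_separable pR; have sS := pprod_separable pS.
have [t0' t1'] := (ltW t0, ltW t1).
exists t, R, S; split=> //; split; try by move=> e; rewrite e in RX RY.
by apply: Phi_inj; try apply: separable_convex; rewrite ?Phi_aff.
Qed.

(** The coordinate-preserving outcome of the rook alternative. The exchanging outcome is [straight]
    for [Phi] followed by [swapmx], so one notion serves both. *)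
Definition straight : Prop :=
  (forall P Q Q', pure P -> pure Q -> pure Q' ->
     ptr1 (Phi (kronmx P Q)) = ptr1 (Phi (kronmx P Q'))) /\
  (forall P P' Q, pure P -> pure P' -> pure Q ->
     ptr2 (Phi (kronmx P Q)) = ptr2 (Phi (kronmx P' Q))).

Lemma iso_kron P Q : pure P -> pure Q ->
  [/\ pure (ptr1 (Phi (kronmx P Q))), pure (ptr2 (Phi (kronmx P Q)))
    & Phi (kronmx P Q) = kronmx (ptr1 (Phi (kronmx P Q))) (ptr2 (Phi (kronmx P Q)))].
Proof.
move=> pP pQ; have [|R [S [pR pS ->]]] := @iso_pprod (kronmx P Q); first by exists P, Q.
by rewrite !(ptr1_kron, ptr2_kron) ?pure_tr.
Qed.

Lemma straight_tensor : (0 < m)%N -> (0 < n)%N -> straight ->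
  exists psi1 psi2,
    [/\ affine_iso (@state C m) (@state C m') psi1,
        affine_iso (@state C n) (@state C n') psi2,
        forall w s, state w -> state s -> Phi (kronmx w s) = kronmx (psi1 w) (psi2 s)
      & (m <= m')%N /\ (n <= n')%N].
Proof.
have [Phi_sep Phi_inj Phi_surj Phi_aff] := Phi_iso => m0 n0 [st1 st2].
pose P0 : 'M[C]_m := delta_mx (Ordinal m0) (Ordinal m0).
pose Q0 : 'M[C]_n := delta_mx (Ordinal n0) (Ordinal n0).
have pP0 : pure P0 by apply: pure_delta.
have pQ0 : pure Q0 by apply: pure_delta.
have [sP0 sQ0] := (pure_state pP0, pure_state pQ0).
(* By straightness the reference states [P0] and [Q0] do not affect the values on pure states;
   affinity in each slot then extends the product formula to all states. *)
pose psi1 w := ptr1 (Phi (kronmx w Q0)); pose psi2 s := ptr2 (Phi (kronmx P0 s)).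
have Phi_pure P Q : pure P -> pure Q -> Phi (kronmx P Q) = kronmx (psi1 P) (psi2 Q).
  move=> pP pQ; have [_ _ ->] := iso_kron pP pQ.
  by rewrite (st1 P Q Q0)// (st2 P P0 Q).
have aff1 s : state s -> affine_on (@state C m) (fun w => Phi (kronmx w s)).
  by move=> ss t w w' t0 t1 sw sw'; rewrite kronmx_combl Phi_aff//; apply: kron_separable.
have aff2 w : state w -> affine_on (@state C n) (fun s => Phi (kronmx w s)).
  by move=> sw t s s' t0 t1 ss ss'; rewrite kronmx_combr Phi_aff//; apply: kron_separable.
have psi1_aff : affine_on (@state C m) psi1.
  by move=> t w w' t0 t1 sw sw'; rewrite /psi1 (aff1 _ sQ0)// linearP linearZ.
have psi2_aff : affine_on (@state C n) psi2.
  by move=> t w w' t0 t1 sw sw'; rewrite /psi2 (aff2 _ sP0)// linearP linearZ.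
have Phi_tensor w s : state w -> state s -> Phi (kronmx w s) = kronmx (psi1 w) (psi2 s).
  move=> sw /state_pure_sum[mu [Q [wmu pQ sE]]].
  have sQ i : state (Q i) by apply: pure_state.
  have [_ Q1] := affine_on_sum (@state_convex C n) (aff2 _ sw) wmu sQ.
  have [_ Q2] := affine_on_sum (@state_convex C n) psi2_aff wmu sQ.
  rewrite sE Q1 Q2 kronmx_sumr; apply: eq_bigr => j _; congr (_ *: _).
  case/state_pure_sum: sw => lam [P [wl pP wE]].
  have sP i : state (P i) by apply: pure_state.
  have [_ R1] := affine_on_sum (@state_convex C m) (aff1 _ (sQ j)) wl sP.
  have [_ R2] := affine_on_sum (@state_convex C m) psi1_aff wl sP.
  by rewrite wE R1 R2 kronmx_suml; apply: eq_bigr => i _; rewrite Phi_pure.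
have pure1 P : pure P -> pure (psi1 P) by move=> pP; have [] := iso_kron pP pQ0.
have pure2 Q : pure Q -> pure (psi2 Q) by move=> pQ; have [] := iso_kron pP0 pQ.
have inj1 w w' : state w -> state w' -> psi1 w = psi1 w' -> w = w'.
  move=> sw sw' e; rewrite -(ptr1_kron w (pure_tr pQ0)) -(ptr1_kron w' (pure_tr pQ0)).
  congr ptr1; apply: Phi_inj; try exact: kron_separable.
  by rewrite !Phi_tensor// e.
have inj2 w w' : state w -> state w' -> psi2 w = psi2 w' -> w = w'.
  move=> sw sw' e; rewrite -(ptr2_kron w (pure_tr pP0)) -(ptr2_kron w' (pure_tr pP0)).
  congr ptr2; apply: Phi_inj; try exact: kron_separable.
  by rewrite !Phi_tensor// e.
have preim R S : pure R -> pure S ->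
    exists P Q, [/\ pure P, pure Q, psi1 P = R & psi2 Q = S].
  move=> pR pS; have [|_ [P [Q [pP pQ ->]]] E] := @iso_pprod_preim (kronmx R S).
    by exists R, S.
  exists P, Q; rewrite Phi_pure// in E; split=> //.
  - by move/(congr1 (@ptr1 _ m' n')): E; rewrite !ptr1_kron ?pure_tr//; apply: pure2.
  - by move/(congr1 (@ptr2 _ m' n')): E; rewrite !ptr2_kron ?pure_tr//; apply: pure1.
have preim1 R : pure R -> exists2 P, pure P & psi1 P = R.
  by move=> pR; have [P [Q [? ? ? ?]]] := preim R _ pR (pure2 _ pQ0); exists P.
have preim2 S : pure S -> exists2 Q, pure Q & psi2 Q = S.
  by move=> pS; have [P [Q [? ? ? ?]]] := preim _ S (pure1 _ pP0) pS; exists Q.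
exists psi1, psi2; split=> //; [exact: affine_iso_of_pure|exact: affine_iso_of_pure|].
by split; [apply: (affine_iso_dim psi1_aff)|apply: (affine_iso_dim psi2_aff)].
Qed.

End Rectangular.

Lemma iso_swap m n m' n' (Phi : 'M[C]_(m * n) -> 'M[C]_(m' * n')) :
  affine_iso (@separable C m n) (@separable C m' n') Phi ->
  affine_iso (@separable C m n) (@separable C n' m') (fun X => swapmx (Phi X)).
Proof.
case=> sep inj surj aff; split.
- by move=> X /sep/separable_swap.
- by move=> X Y sX sY /(can_inj (@swapmxK _ _ _)); apply: inj.
- move=> Y /separable_swap/surj[X sX XY]; exists X => //.
  by rewrite XY swapmxK.
- by move=> t X Y t0 t1 sX sY; rewrite aff// linearP linearZ.
Qed.

Lemma iso_straight_or_swapped m n (Phi : 'M[C]_(m * n) -> 'M[C]_(m * n)) :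
  affine_iso (@separable C m n) (@separable C m n) Phi ->
  straight Phi \/ straight (fun X => swapmx (Phi X)).
Proof.
move=> Phi_iso; have [Phi_sep Phi_inj _ _] := Phi_iso.
have kron_sep P Q : pure P -> pure Q -> separable (kronmx P Q : 'M[C]_(m * n)).
  by move=> /pure_state sP /pure_state sQ; apply: kron_separable.
(* A factor of dimension at most 1 has at most one state, so both conditions of [straight] are
   immediate; otherwise each factor has two distinct pure states, as the rook lemma requires. *)
have [m1|m1] := leqP m 1.
  left; split=> [P Q Q' pP pQ pQ'|P P' Q pP pP' pQ].
    by apply: state_dim1 => //; apply/ptr1_state/Phi_sep/kron_sep.
  by rewrite (state_dim1 m1 (pure_state pP) (pure_state pP')).
have [n1|n1] := leqP n 1.
  left; split=> [P Q Q' pP pQ pQ'|P P' Q pP pP' pQ].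
    by rewrite (state_dim1 n1 (pure_state pQ) (pure_state pQ')).
  by apply: state_dim1 => //; apply/ptr2_state/Phi_sep/kron_sep.
have [P0 [P1 [pP0 pP1 nP]]] := two_pure C m1.
have [Q0 [Q1 [pQ0 pQ1 nQ]]] := two_pure C n1.
pose f P Q := ptr1 (Phi (kronmx P Q)); pose g P Q := ptr2 (Phi (kronmx P Q)).
have fgE P Q : pure P -> pure Q -> Phi (kronmx P Q) = kronmx (f P Q) (g P Q).
  by move=> pP pQ; have [] := iso_kron Phi_iso pP pQ.
have pf P Q : pure P -> pure Q -> pure (f P Q).
  by move=> pP pQ; have [] := iso_kron Phi_iso pP pQ.
have pg P Q : pure P -> pure Q -> pure (g P Q).
  by move=> pP pQ; have [] := iso_kron Phi_iso pP pQ.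
have kp P Q : pure P -> pure Q -> pprod (kronmx P Q : 'M[C]_(m * n)).
  by move=> pP pQ; exists P, Q.
have split_fg P P' Q Q' : pure P -> pure P' -> pure Q -> pure Q' ->
    midpoint_splits (kronmx P Q) (kronmx P' Q') <->
    midpoint_splits (kronmx (f P Q) (g P Q)) (kronmx (f P' Q') (g P' Q')).
  by move=> *; rewrite -!fgE//; apply: iso_midpoint_splits => //; apply: kp.
have fg_inj P P' Q Q' : pure P -> pure P' -> pure Q -> pure Q' ->
    f P Q = f P' Q' -> g P Q = g P' Q' -> P = P' /\ Q = Q'.
  move=> pP pP' pQ pQ' ef eg.
  have E : kronmx P Q = kronmx P' Q' :> 'M[C]_(m * n).
    by apply: Phi_inj; try exact: kron_sep; rewrite !fgE// ef eg.
  split.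
  - by move/(congr1 (@ptr1 _ m n)): E; rewrite !ptr1_kron ?pure_tr.
  - by move/(congr1 (@ptr2 _ m n)): E; rewrite !ptr2_kron ?pure_tr.
have [|||S|S] := rook_automorphism fg_inj _ _ _ pP0 pP1 nP pQ0 pQ1 nQ.
- move=> P Q Q' pP pQ pQ'; have [->|/eqP nQQ] := eqVneq Q Q'; first by left.
  apply: midpoint_splits_share; try (by apply: pf); try (by apply: pg).
  by apply: (split_fg P P Q Q' _ _ _ _).1 => //; apply: midpoint_splits_sharel.
- move=> P P' Q pP pP' pQ; have [->|/eqP nPP] := eqVneq P P'; first by left.
  apply: midpoint_splits_share; try (by apply: pf); try (by apply: pg).
  by apply: (split_fg P P' Q Q _ _ _ _).1 => //; apply: midpoint_splits_sharer.
(* Images sharing one marginal differ in the other by injectivity, so their midpoint splits; then so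
   does that of the originals, which share no factor. *)
- move=> P P' Q Q' pP pP' pQ pQ' nPP nQQ.
  have no : ~ midpoint_splits (kronmx (f P Q) (g P Q)) (kronmx (f P' Q') (g P' Q')).
    by move=> /(split_fg _ _ _ _ pP pP' pQ pQ').2/midpoint_splits_share[].
  split=> e; apply: no; rewrite e.
  + apply: midpoint_splits_sharel; try (by apply: pf); try (by apply: pg).
    by move=> e'; have [] := fg_inj _ _ _ _ pP pP' pQ pQ' e e'.
  + apply: midpoint_splits_sharer; try (by apply: pf); try (by apply: pg).
    by move=> e'; have [] := fg_inj _ _ _ _ pP pP' pQ pQ' e' e.
- left; split=> [P Q Q' pP pQ pQ'|P P' Q pP pP' pQ].
    by have [+ _] := S P Q pP pQ; apply.
  by have [_ +] := S P Q pP pQ; apply.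
- right; split=> [P Q Q' pP pQ pQ'|P P' Q pP pP' pQ]; rewrite !fgE// !swapmx_kron.
    by have [+ _] := S P Q pP pQ => /(_ Q' pQ') e; rewrite !ptr1_kron ?pure_tr//; apply: pf.
  by have [_ +] := S P Q pP pQ => /(_ P' pP') e; rewrite !ptr2_kron ?pure_tr//; apply: pg.
Qed.

(** A Kronecker product determines its factors up to scalars, and trace one removes that freedom:
    fix the maximally mixed state in the other slot and take a partial trace. *)
Lemma tensor_unique m n (psi1 phi1 : 'M[C]_m -> 'M[C]_m) (psi2 phi2 : 'M[C]_n -> 'M[C]_n) :
  (0 < m)%N -> (0 < n)%N ->
  affine_aut (@state C m) psi1 -> affine_aut (@state C n) psi2 ->
  affine_aut (@state C m) phi1 -> affine_aut (@state C n) phi2 ->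
  (forall w s, state w -> state s ->
     kronmx (phi1 w) (phi2 s) = kronmx (psi1 w) (psi2 s)) ->
  (forall w, state w -> phi1 w = psi1 w) /\ (forall s, state s -> phi2 s = psi2 s).
Proof.
move=> m0 n0 [a1 _] [a2 _] [b1 _] [b2 _] E; split=> w sw.
- have ss := max_mixed_state C n0.
  move/(congr1 (@ptr1 _ m n)): (E _ _ sw ss).
  by rewrite !ptr1_kron ?(a2 _ ss).2 ?(b2 _ ss).2.
- have ss := max_mixed_state C m0.
  move/(congr1 (@ptr2 _ m n)): (E _ _ ss sw).
  by rewrite !ptr2_kron ?(a1 _ ss).2 ?(b1 _ ss).2.
Qed.

Lemma straight_aut m n (Phi : 'M[C]_(m * n) -> 'M[C]_(m * n)) :
  (0 < m)%N -> (0 < n)%N ->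
  affine_iso (@separable C m n) (@separable C m n) Phi -> straight Phi ->
  exists_unique_auts (fun psi1 psi2 => is_tensor_of Phi psi1 psi2).
Proof.
move=> m0 n0 Phi_iso st.
have [psi1 [psi2 [i1 i2 T _]]] := straight_tensor Phi_iso m0 n0 st.
have [a1 a2] : affine_aut (@state C m) psi1 /\ affine_aut (@state C n) psi2.
  by split; apply/affine_iso_aut.
exists psi1, psi2; split=> // phi1 phi2 b1 b2 T'.
by apply: tensor_unique => // w s sw ss; rewrite -T// T'.
Qed.

End SeparableIso.

Theorem mainTheorem9 (C : numClosedFieldType) :
  (forall (m n : nat) (Phi : 'M[C]_(m * n) -> 'M[C]_(m * n)),
     (0 < m)%N -> (0 < n)%N -> m <> n ->
     affine_aut (@separable C m n) Phi ->
     exists_unique_auts (fun psi1 psi2 => is_tensor_of Phi psi1 psi2))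
  /\
  (forall (m : nat) (Phi : 'M[C]_(m * m) -> 'M[C]_(m * m)),
     (0 < m)%N ->
     affine_aut (@separable C m m) Phi ->
     exists_unique_auts (fun psi1 psi2 => is_tensor_of Phi psi1 psi2)
     \/ exists_unique_auts (fun psi1 psi2 => is_swap_tensor_of Phi psi1 psi2)).
Proof.
split=> [m n Phi m0 n0 nmn /affine_iso_aut Phi_iso|m Phi m0 /affine_iso_aut Phi_iso].
  have [st|sw] := iso_straight_or_swapped Phi_iso; first exact: straight_aut.
  (* The swapped map goes from $S_{m,n}$ to $S_{n,m}$, so its tensor factors give both $m \le n$ and
     $n \le m$. *)
  have [_ [_ [_ _ _ [mn nm]]]] := straight_tensor (iso_swap Phi_iso) m0 n0 sw.
  by case: nmn; apply/eqP; rewrite eqn_leq mn.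
have [st|sw] := iso_straight_or_swapped Phi_iso; [left; exact: straight_aut|right].
(* The swap is an involution, so existence and uniqueness for the swapped map transfer back to
   [Phi]. *)
have [psi1 [psi2 [a1 a2 T uniq]]] := straight_aut m0 m0 (iso_swap Phi_iso) sw.
exists psi1, psi2; split=> // [w s sw' ss|phi1 phi2 b1 b2 T'].
  by rewrite -[LHS]swapmxK T// swapmx_kron.
by apply: uniq => // w s sw' ss; rewrite T'// swapmx_kron.
Qed.
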